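(* Let $\mathcal{C}\subset\mathbb{N}^p$ be an integer polyhedral cone. Then the quasi-elasticity $\rho$ is not bounded on the family of $\mathcal{C}$-semigroups: for every real number $M$ there exists a $\mathcal{C}$-semigroup $S\neq\mathcal{C}$ with $\rho(S)>M$.
   Context: $\mathbb{N}$ denotes the non-negative integers. An integer polyhedral cone $\mathcal{C}\subset\mathbb{N}^p$ is the set of points of $\mathbb{N}^p$ lying in the real cone $\{\sum_i\lambda_i v_i:\lambda_i\in\mathbb{R}_{\ge 0}\}$ generated by finitely many vectors $v_1,\dots,v_n\in\mathbb{N}^p$, not all zero. A $\mathcal{C}$-semigroup is a finitely generated additive submonoid $S$ (containing $0$) of $\mathcal{C}$ such that $\mathcal{H}(S)=\mathcal{C}\setminus S$ (the gap set) is finite. Define $x\leq_{\mathcal{C}}y\iff y-x\in\mathcal{C}$, and let $\mathfrak{F}(S)$ be the set of maximal elements of $\mathcal{H}(S)$ with respect to $\leq_{\mathcal{C}}$. The weight of $(x_1,\dots,x_p)\in\mathbb{N}^p$ is $w(x_1,\dots,x_p)=x_1+\cdots+x_p$, and $w(A)=\{w(a):a\in A\}$ for $A\subset\mathbb{N}^p$. For a $\mathcal{C}$-semigroup $S\ne\mathcal{C}$, the quasi-elasticity is $\rho(S)=\dfrac{\max w(\mathfrak{F}(S))}{\min w(\mathfrak{F}(S))}$.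
   Formalization: The cone C is additionally assumed to span a real space of dimension at least 2; if C lies on a single ray (e.g. C = N), the order is total, F(S) is a singleton and ρ(S) = 1 for every S ≠ C, so the claim fails there. *)

(* Defs.v *)
From HB Require Import structures.
From mathcomp Require Import all_boot all_order all_algebra.
From mathcomp Require Import boolp classical_sets cardinality reals.

Set Implicit Arguments.
Unset Strict Implicit.
Unset Printing Implicit Defensive.

Import Order.TTheory GRing.Theory Num.Theory.
Local Open Scope ring_scope.
Local Open Scope classical_set_scope.

Definition to_real (R : realType) (m p : nat) (A : 'M[nat]_(m, p)) :
  'M[R]_(m, p) := map_mx (fun k : nat => k%:R) A.

(* The generators are the rows of v. *)
Definition integer_cone_of (R : realType) (n p : nat) (v : 'M[nat]_(n, p)) :
  set 'rV[nat]_p :=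
  [set x | exists lam : 'rV[R]_n,
     (forall i, 0 <= lam 0 i) /\ to_real R x = lam *m to_real R v].

Definition is_integer_cone (R : realType) (p : nat) (C : set 'rV[nat]_p) :
  Prop :=
  exists (n : nat) (v : 'M[nat]_(n, p)), v != 0 /\ C = integer_cone_of R v.

(* The real span of C has dimension at least 2, i.e. C does not lie on a
   single ray.  On a ray the order cone_le is total, so that every
   quasi-elasticity is equal to 1. *)
Definition dim_ge2 (R : realType) (p : nat) (C : set 'rV[nat]_p) : Prop :=
  exists x y, [/\ C x, C y & row_free (col_mx (to_real R x) (to_real R y))].

Definition submonoid (p : nat) (S : set 'rV[nat]_p) : Prop :=
  S 0 /\ (forall x y, S x -> S y -> S (x + y)).

Definition finitely_generated (p : nat) (S : set 'rV[nat]_p) : Prop :=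
  exists (n : nat) (g : 'I_n -> 'rV[nat]_p),
    S = [set x | exists c : 'I_n -> nat, x = \sum_i g i *+ c i].

Definition gaps (p : nat) (C S : set 'rV[nat]_p) : set 'rV[nat]_p := C `\` S.

Definition C_semigroup (p : nat) (C S : set 'rV[nat]_p) : Prop :=
  [/\ S `<=` C, submonoid S, finitely_generated S & finite_set (gaps C S)].

(* y - x \in C, written without subtraction: C is made of vectors of
   naturals, so y - x \in C forces x <= y coordinatewise. *)
Definition cone_le (p : nat) (C : set 'rV[nat]_p) (x y : 'rV[nat]_p) : Prop :=
  exists2 z, C z & y = x + z.

Definition maximal_gaps (p : nat) (C S : set 'rV[nat]_p) : set 'rV[nat]_p :=
  [set x | gaps C S x /\
     forall y, gaps C S y -> cone_le C x y -> y = x].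

Definition weight (p : nat) (x : 'rV[nat]_p) : nat := (\sum_(i < p) x ord0 i)%N.

(* The greatest and least elements of A, with the junk value 0 when there is
   none; A is finite and nonempty in quasi_elasticity when S is a
   C-semigroup different from C. *)
Definition max_of (A : set nat) : nat :=
  xget 0%N [set m | A m /\ forall k, A k -> (k <= m)%N].

Definition min_of (A : set nat) : nat :=
  xget 0%N [set m | A m /\ forall k, A k -> (m <= k)%N].

Definition quasi_elasticity (R : realType) (p : nat) (C S : set 'rV[nat]_p) :
  R :=
  (max_of (@weight p @` maximal_gaps C S))%:R /
  (min_of (@weight p @` maximal_gaps C S))%:R.

(* Main.v *)
(* Let w be the weight and let j be a coordinate such that x_j / w(x) is not
   constant on C.  If y in C maximises this ratio and x in C does not, then
   y_j w(z) - z_j w(y) is a linear form, nonnegative on C, vanishing at y and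
   positive at x, so x <=_C k y holds for no k.  The nonzero elements of C below
   x or below k y are the gaps of a C-semigroup whose maximal gaps are x and
   k y (k large), and its quasi-elasticity k w(y) / w(x) is unbounded in k. *)
Require Import Defs.
From HB Require Import structures.
From mathcomp Require Import all_boot all_order all_algebra.
From mathcomp Require Import boolp classical_sets cardinality reals.
From mathcomp Require Import ring.

Import Order.TTheory GRing.Theory Num.Theory.
Local Open Scope ring_scope.
Local Open Scope classical_set_scope.

(** * Weight of vectors, and finite generation by elements of bounded weight *)

Section Weight.
Context {p : nat}.
Implicit Types x y z : 'rV[nat]_p.

Lemma coordMn x k j : (x *+ k) ord0 j = (x ord0 j * k)%N.
Proof. by rewrite mulmxnE -mulr_natr natn. Qed.

Lemma weight0 : weight (0 : 'rV[nat]_p) = 0%N.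
Proof. by rewrite /weight big1 // => i _; rewrite mxE. Qed.

Lemma weightD x y : weight (x + y) = (weight x + weight y)%N.
Proof. by rewrite /weight -big_split; apply: eq_bigr => i _; rewrite mxE. Qed.

Lemma weightMn x k : weight (x *+ k) = (weight x * k)%N.
Proof.
elim: k => [|k IH]; first by rewrite mulr0n weight0 muln0.
by rewrite mulrS weightD IH mulnS.
Qed.

Lemma leq_coord_weight x j : (x ord0 j <= weight x)%N.
Proof. by rewrite /weight (bigD1 j) //= leq_addr. Qed.

Lemma weight_eq0 x : (weight x == 0%N) = (x == 0).
Proof.
apply/idP/eqP => [/eqP w0|->]; last by rewrite weight0.
apply/rowP => j; rewrite mxE; apply/eqP.
by rewrite -leqn0 -[X in (_ <= X)%N]w0 leq_coord_weight.
Qed.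

Lemma weight_le_ffun {B x} : (weight x <= B)%N ->
  exists f : {ffun 'I_p -> 'I_B.+1}, x = \row_j (f j : nat).
Proof.
move=> xB; exists [ffun j => inord (x ord0 j)]; apply/rowP => j.
by rewrite mxE ffunE inordK // ltnS (leq_trans (leq_coord_weight x j)).
Qed.

Lemma finite_weight_le B : finite_set [set x : 'rV[nat]_p | (weight x <= B)%N].
Proof.
apply: (sub_finite_set (B := [set \row_j (f j : nat) |
  f in (setT : set {ffun 'I_p -> 'I_B.+1})])); last first.
  exact/finite_image/finite_finset.
by move=> x /weight_le_ffun[f ->]; exists f.
Qed.

(** Strong induction on the weight: both summands of a decomposition are nonzero, hence strictly
    lighter than [s], so splitting ends in elements of weight at most [B], which serve as
    generators. *)
Lemma weight_bounded_generators (S : set 'rV[nat]_p) B : submonoid S ->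
  (forall s, S s -> (B < weight s)%N ->
     exists a b, [/\ S a, S b, a != 0, b != 0 & s = a + b]) ->
  finitely_generated S.
Proof.
move=> [S0 SD] dec.
pose T := {ffun 'I_p -> 'I_B.+1}.
(* The index runs over all vectors with coordinates at most [B]; those outside [S] are replaced by
   0, which is harmless in a monoid. *)
pose g (i : 'I_#|T|) := let x := \row_j (enum_val i j : nat) in
  if `[< S x >] then x else 0.
have Sg i : S (g i) by rewrite /g; case: asboolP.
exists #|T|, g; apply/seteqP; split => [s|s [c ->]]; last first.
  elim/big_ind: _ => // i _; elim: (c i) => [|k IH]; first by rewrite mulr0n.
  by rewrite mulrS; apply: SD.
have [m] := ubnP (weight s); elim: m s => // m IH s; rewrite ltnS => sm Ss.
have [sB|Bs] := leqP (weight s) B.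
  have [f fE] := weight_le_ffun sB.
  exists (fun i => (i == enum_rank f) : nat).
  rewrite (bigD1 (enum_rank f)) //= eqxx mulr1n big1 ?addr0 => [|i /negPf ->];
    last by rewrite mulr0n.
  by rewrite /g enum_rankK -fE; case: asboolP.
have [a [b [Sa Sb a0 b0 sab]]] := dec s Ss Bs.
move: a0 b0 sm; rewrite -!weight_eq0 -!lt0n sab weightD => a0 b0 sm.
have [|//|ca cE] := IH a; first by apply: leq_trans sm; rewrite -addn1 leq_add2l.
have [|//|cb cE'] := IH b; first by apply: leq_trans sm; rewrite -add1n leq_add2r.
exists (fun i => (ca i + cb i)%N); rewrite cE cE' -big_split /=.
by apply: eq_bigr => i _; rewrite mulrnDr.
Qed.

End Weight.

(** * Integer cones: finite generation of cofinite submonoids, and a separating linear form *)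

Section Cone.
Context {R : realType} {n p : nat} (v : 'M[nat]_(n, p)).
Local Notation C := (integer_cone_of R v).
Implicit Types (x y z : 'rV[nat]_p) (lam : 'I_n -> R).

Lemma integer_coneP x : C x <-> exists lam, (forall i, 0 <= lam i) /\
  forall j, (x ord0 j)%:R = \sum_i lam i * (v i j)%:R.
Proof.
split=> [[lam [lam0 /rowP E]]|[lam [lam0 E]]].
  exists (lam 0); split=> // j; have := E j; rewrite !mxE => ->.
  by apply: eq_bigr => i _; rewrite mxE.
exists (\row_i lam i); split=> [i|]; first by rewrite mxE.
apply/rowP => j; rewrite !mxE E; apply: eq_bigr => i _.
by rewrite !mxE.
Qed.

Lemma combination_form {lam x} (a : 'I_p -> R) :
  (forall j, (x ord0 j)%:R = \sum_i lam i * (v i j)%:R) ->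
  \sum_j a j * (x ord0 j)%:R = \sum_i lam i * \sum_j a j * (v i j)%:R.
Proof.
move=> E; under eq_bigr do rewrite E mulr_sumr.
rewrite exchange_big; apply: eq_bigr => i _; rewrite mulr_sumr.
by apply: eq_bigr => j _; rewrite mulrCA.
Qed.

Lemma combination_weight {lam x} :
  (forall j, (x ord0 j)%:R = \sum_i lam i * (v i j)%:R) ->
  (weight x)%:R = \sum_i lam i * (weight (row i v))%:R.
Proof.
move=> E; transitivity (\sum_j 1 * (x ord0 j)%:R : R).
  by rewrite natr_sum; apply: eq_bigr => j _; rewrite mul1r.
rewrite (combination_form (fun=> 1) E); apply: eq_bigr => i _.
rewrite natr_sum; congr (_ * _).
by apply: eq_bigr => j _; rewrite mul1r mxE.
Qed.

Lemma integer_cone0 : C 0.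
Proof.
apply/integer_coneP; exists (fun=> 0); split=> // j.
by rewrite mxE big1 // => i _; rewrite mul0r.
Qed.

Lemma integer_coneD x y : C x -> C y -> C (x + y).
Proof.
move=> /integer_coneP[l [l0 lE]] /integer_coneP[m [m0 mE]].
apply/integer_coneP; exists (fun i => l i + m i).
split=> [i|j]; first exact: addr_ge0.
rewrite mxE natrD lE mE -big_split; apply: eq_bigr => i _.
by rewrite mulrDl.
Qed.

Lemma integer_cone_row i : C (row i v).
Proof.
apply/integer_coneP; exists (fun k => (k == i)%:R); split=> [k|j].
  by rewrite ler0n.
rewrite mxE (bigD1 i) //= eqxx mul1r big1 ?addr0 // => k /negPf ->.
by rewrite mul0r.
Qed.

(* If s is heavy, some generator u occurs in it with coefficient > 2D, so
   s - D u is still in C and has weight at least D. *)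
Lemma cofinite_submonoid_fg (S : set 'rV[nat]_p) D :
  S `<=` C -> submonoid S -> (0 < D)%N ->
  (forall z, C z -> (D <= weight z)%N -> S z) -> finitely_generated S.
Proof.
move=> SC Smon D0 heavyS.
(* A bound for the weight of every combination in which the generators of positive weight have
   coefficients at most 2D. *)
pose B := (\sum_i D.*2 * weight (row i v))%N.
apply: (weight_bounded_generators S B Smon) => s Ss Bs.
have /integer_coneP[lam [lam0 sE]] := SC _ Ss.
have wE := combination_weight sE.
have [i vi0 lami] : exists2 i, (0 < weight (row i v))%N & D.*2%:R < lam i.
  apply: contrapT => noi; move: Bs; rewrite ltnNge => /negP; apply.
  rewrite -(ler_nat R) wE natr_sum; apply: ler_sum => i _; rewrite natrM.
  have [->|vi0] := posnP (weight (row i v)); first by rewrite !mulr0.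
  rewrite ler_pM2r ?ltr0n // leNgt; apply/negP => lami.
  by apply: noi; exists i.
(* This makes the truncated subtraction in [b] below exact. *)
have vD j : (v i j * D <= s ord0 j)%N.
  rewrite -(ler_nat R) sE (bigD1 i) //= natrM mulrC.
  apply: (le_trans (y := lam i * (v i j)%:R)).
    rewrite ler_wpM2r ?ler0n // (le_trans _ (ltW lami)) // ler_nat -addnn.
    exact: leq_addr.
  by rewrite lerDl sumr_ge0 // => k _; rewrite mulr_ge0.
pose b : 'rV[nat]_p := \row_j (s ord0 j - v i j * D)%N.
pose mu k := lam k - (k == i)%:R * D%:R.
have muE j : (b ord0 j)%:R = \sum_k mu k * (v k j)%:R.
  rewrite mxE natrB // sE natrM.
  under [RHS]eq_bigr do rewrite mulrBl.
  rewrite sumrB; congr (_ - _).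
  rewrite (bigD1 i) //= eqxx mul1r big1 ?addr0 1?mulrC // => k /negPf ->.
  by rewrite !mul0r.
have mui : D%:R <= mu i.
  rewrite /mu eqxx mul1r lerBrDr -natrD addnn; exact: ltW.
have mu0 k : 0 <= mu k.
  have [->|ki] := eqVneq k i; first exact: le_trans mui.
  by rewrite /mu (negPf ki) mul0r subr0.
(* The coefficient of [row i v] in [b] is still at least D, and this row has weight at least 1. *)
have bD : (D <= weight b)%N.
  rewrite -(ler_nat R) (combination_weight muE) (bigD1 i) //=.
  rewrite -[X in X <= _]addr0 lerD //; last first.
    by apply: sumr_ge0 => k _; rewrite mulr_ge0.
  by rewrite -[X in X <= _]mulr1 ler_pM // ler1n.
have Cb : C b by apply/integer_coneP; exists mu.
have Ca : C (row i v *+ D).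
  elim: (D) => [|k IH]; first by rewrite mulr0n; exact: integer_cone0.
  by rewrite mulrS; apply: integer_coneD => //; exact: integer_cone_row.
have aD : (D <= weight (row i v *+ D))%N by rewrite weightMn leq_pmull.
exists (row i v *+ D), b; split; first exact: heavyS.
- exact: heavyS.
- by rewrite -weight_eq0 -lt0n (leq_trans D0).
- by rewrite -weight_eq0 -lt0n (leq_trans D0).
- apply/rowP => j; rewrite mxE coordMn !mxE.
  by rewrite -[RHS]/(v i j * D + (s ord0 j - v i j * D))%N subnKC.
Qed.

(** The ratio of a coordinate to the weight is maximised over the cone by one of the generators, so
    a maximum over finitely many rows suffices. *)
Lemma exists_not_below_multiples : v != 0 -> dim_ge2 R C ->
  exists x y, [/\ C x, C y, x != 0, y != 0 & forall k, ~ cone_le C x (y *+ k)].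
Proof.
move=> v0 [x [y [Cx Cy free]]].
have indep (a b : R) : a *: to_real R x + b *: to_real R y = 0 -> a = 0 /\ b = 0.
  rewrite -!mul_scalar_mx -mul_row_col => /eqP.
  rewrite mulmx_free_eq0 // => /eqP; rewrite -row_mx0.
  move=> /eq_row_mx[/rowP Ea /rowP Eb].
  by have := Ea 0; have := Eb 0; rewrite !mxE eqxx !mulr1n.
(* Otherwise w(y) x - w(x) y = 0; independence gives w(x) = 0, so x = 0, which independence
   excludes. *)
have [j xyj] : exists j, (x ord0 j)%:R * (weight y)%:R !=
    (y ord0 j)%:R * (weight x)%:R :> R.
  apply: contrapT => noj.
  have [|_ /eqP] := indep (weight y)%:R (- (weight x)%:R).
    apply/rowP => j; rewrite !mxE mulNr; apply/eqP; rewrite subr_eq0.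
    by rewrite mulrC (mulrC (weight x)%:R); apply/negPn/negP => ?; apply: noj; exists j.
  rewrite oppr_eq0 pnatr_eq0 weight_eq0 => /eqP x0.
  have [|/eqP] := indep 1 0; last by rewrite oner_eq0.
  by rewrite x0 scale0r addr0 scale1r; apply/rowP => k; rewrite !mxE.
have [i0 i0P] : exists i0, (0 < weight (row i0 v))%N.
  apply: contrapT => noi; case/eqP: v0; apply/matrixP => i k.
  have : row i v == 0.
    by rewrite -weight_eq0 -leqn0 leqNgt; apply/negP => ?; apply: noi; exists i.
  by move=> /eqP/rowP/(_ k); rewrite !mxE.
(* Zero rows are left out, since their ratio would be the default value of a division by 0. *)
have [i iP imax] := arg_maxP (P := fun i => (0 < weight (row i v))%N)
  (fun i => (v i j)%:R / (weight (row i v))%:R : R) i0P.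
pose phi z : R :=
  (v i j)%:R * (weight z)%:R - (weight (row i v))%:R * (z ord0 j)%:R.
have phi_row k : 0 <= phi (row k v).
  rewrite /phi subr_ge0 mxE.
  have [w0|kP] := posnP (weight (row k v)).
    have /eqP/rowP/(_ j) : row k v == 0 by rewrite -weight_eq0 w0.
    by rewrite !mxE => ->; rewrite w0 !mulr0.
  have := imax k kP; rewrite /= ler_pdivrMr ?ltr0n // mulrAC.
  by rewrite ler_pdivlMr ?ltr0n // mulrC.
have phi_ge0 z : C z -> 0 <= phi z.
  move=> /integer_coneP[lam [lam0 zE]].
  suff -> : phi z = \sum_k lam k * phi (row k v).
    by apply: sumr_ge0 => k _; apply: mulr_ge0.
  rewrite /phi (combination_weight zE) zE !mulr_sumr -sumrB.
  by apply: eq_bigr => k _; rewrite mxE mulrBr !(mulrCA (lam k)).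
have phiD z t : phi (z + t) = phi z + phi t.
  by rewrite /phi weightD mxE !natrD; ring.
have phi_mul k : phi (row i v *+ k) = 0.
  by rewrite /phi weightMn coordMn mxE !natrM; ring.
(* If [phi] vanished at both [x] and [y], both would have the ratio of [row i v], against the choice
   of [j]. *)
have [x0 Cx0 x0P] : exists2 x0, C x0 & phi x0 != 0.
  have [px|] := eqVneq (phi x) 0; last by exists x.
  have [py|] := eqVneq (phi y) 0; last by exists y.
  case/eqP: xyj; apply: (mulfI (x := (weight (row i v))%:R)).
    by rewrite pnatr_eq0 -lt0n.
  move/eqP: px; rewrite subr_eq0 => /eqP px.
  move/eqP: py; rewrite subr_eq0 => /eqP py.
  by rewrite !mulrA -px -py mulrAC.
exists x0, (row i v); split=> //.
- exact: integer_cone_row.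
- by apply: contra_neq x0P => ->; rewrite /phi weight0 mxE !mulr0 subr0.
- by rewrite -weight_eq0 -lt0n.
(* Two nonnegative values with sum 0 are both 0, whereas [phi x0] is not. *)
- move=> k [z Cz kE]; have := phi_mul k; rewrite kE phiD => /eqP.
  by rewrite paddr_eq0 ?phi_ge0 // (negPf x0P).
Qed.

End Cone.

(** * Removing from a cone the nonzero elements below a given set *)

Definition below {p} (C A : set 'rV[nat]_p) : set 'rV[nat]_p :=
  [set z | [/\ C z, z <> 0 & exists2 a, A a & cone_le C z a]].

Section Below.
Context {p : nat} (C A : set 'rV[nat]_p).
Hypotheses (C0 : C 0) (CD : forall x y, C x -> C y -> C (x + y)).
Implicit Types x y z : 'rV[nat]_p.

Lemma cone_le_weight x y : cone_le C x y -> (weight x <= weight y)%N.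
Proof. by case=> z _ ->; rewrite weightD leq_addr. Qed.

Lemma cone_le_refl x : cone_le C x x.
Proof. by exists 0; rewrite ?addr0. Qed.

Lemma cone_le_trans {y x z} : cone_le C x y -> cone_le C y z -> cone_le C x z.
Proof.
by move=> [u Cu ->] [t Ct ->]; exists (u + t); [exact: CD|rewrite addrA].
Qed.

Lemma cone_le_anti x y : cone_le C x y -> cone_le C y x -> y = x.
Proof.
move=> [z _ ->] /cone_le_weight; rewrite weightD -[X in (_ <= X)%N]addn0.
by rewrite leq_add2l leqn0 weight_eq0 => /eqP ->; rewrite addr0.
Qed.

Lemma gaps_setD_below : gaps C (C `\` below C A) = below C A.
Proof. by rewrite /gaps setDD; apply/setIidPr => z []. Qed.

(** The removed set is closed downwards among nonzero elements: if x + y is removed and x is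
    nonzero, then x, lying below x + y, is removed too; if x = 0, the sum is y. *)
Lemma submonoid_setD_below : submonoid (C `\` below C A).
Proof.
split=> [|x y [Cx Hx] [Cy Hy]]; first by split=> // -[].
split; first exact: CD.
move=> [Cxy xy0 [a Aa xya]]; have [x0|/eqP x0] := eqVneq x 0.
  by apply: Hy; split=> //; [move: xy0|exists a => //; move: xya];
    rewrite x0 add0r.
apply: Hx; split=> //; exists a => //; apply: cone_le_trans xya.
by exists y.
Qed.

(** Each gap lies below an element of [A], itself a gap, so a maximal gap is in [A]; the antichain
    condition makes all of [A] maximal. *)
Lemma maximal_gaps_setD_below : A `<=` C -> ~ A 0 ->
  (forall a b, A a -> A b -> cone_le C a b -> a = b) ->
  maximal_gaps C (C `\` below C A) = A.
Proof.
move=> AC A0 anti.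
have Abelow a : A a -> below C A a.
  move=> Aa; split; [exact: AC|by move=> a0; apply: A0; rewrite -a0|].
  by exists a => //; exact: cone_le_refl.
rewrite /maximal_gaps gaps_setD_below.
apply/seteqP; split=> [z [[Cz z0 [a Aa za]] zmax]|a Aa].
  by rewrite -(zmax a (Abelow a Aa) za).
split=> [|y [Cy y0 [b Ab yb]] ay]; first exact: Abelow.
have ab := anti a b Aa Ab (cone_le_trans ay yb).
by apply: cone_le_anti => //; rewrite ab.
Qed.

End Below.

(** The order increases the weight, so [B] bounds the weight of all gaps: they are finite in number,
    and finite generation follows with threshold [B.+1]. *)
Lemma C_semigroup_setD_below {R : realType} {n p : nat} (v : 'M[nat]_(n, p))
    (A : set 'rV[nat]_p) B : (forall a, A a -> (weight a <= B)%N) ->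
  C_semigroup (integer_cone_of R v)
    (integer_cone_of R v `\` below (integer_cone_of R v) A).
Proof.
move=> AB; set C := integer_cone_of R v.
have belowB z : below C A z -> (weight z <= B)%N.
  by move=> [_ _ [a Aa /cone_le_weight za]]; exact: leq_trans (AB a Aa).
have Smon : submonoid (C `\` below C A).
  by apply: submonoid_setD_below; [exact: integer_cone0|exact: integer_coneD].
split=> //; last first.
  rewrite gaps_setD_below; exact: sub_finite_set (finite_weight_le B).
apply: (cofinite_submonoid_fg (R := R) v _ B.+1) => // z Cz Bz.
by split=> // /belowB; rewrite leqNgt Bz.
Qed.

(** * Extremal weights and the semigroups of large quasi-elasticity *)

Lemma max_ofE (A : set nat) m : A m -> (forall k, A k -> (k <= m)%N) ->
  max_of A = m.
Proof.
move=> Am mmax; rewrite /max_of; case: xgetP => [k _ [Ak kmax]|/(_ m)]; last first.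
  by case.
by apply/eqP; rewrite eqn_leq mmax //= kmax.
Qed.

Lemma min_ofE (A : set nat) m : A m -> (forall k, A k -> (m <= k)%N) ->
  min_of A = m.
Proof.
move=> Am mmin; rewrite /min_of; case: xgetP => [k _ [Ak kmin]|/(_ m)]; last first.
  by case.
by apply/eqP; rewrite eqn_leq kmin //= mmin.
Qed.

Theorem proposition4 (R : realType) (p : nat) (C : set 'rV[nat]_p)
  (hC : is_integer_cone R C) (hdim : dim_ge2 R C) (M : R) :
  exists S : set 'rV[nat]_p,
    [/\ C_semigroup C S, S <> C & M < quasi_elasticity R C S].
Proof.
have [n [v [v0 CE]]] := hC; subst C; set C := integer_cone_of R v.
have C0 : C 0 by exact: integer_cone0.
have CD x y : C x -> C y -> C (x + y) by exact: integer_coneD.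
have [x [y [Cx Cy x0 y0 xNy]]] := exists_not_below_multiples v v0 hdim.
have wx : (0 < weight x)%N by rewrite lt0n weight_eq0.
have wy : (0 < weight y)%N by rewrite lt0n weight_eq0.
(* The first bound makes [y *+ k] strictly heavier than [x], hence not below it; the second,
   archimedean, makes its weight exceed M w(x). *)
pose k := maxn (weight x).+1 (Num.bound `|M * (weight x)%:R|).
have kP : (k <= weight (y *+ k))%N by rewrite weightMn leq_pmull.
have xk : (weight x < weight (y *+ k))%N by rewrite (leq_trans _ kP) // leq_maxl.
have Mk : M * (weight x)%:R < (weight (y *+ k))%:R.
  apply: lt_le_trans (le_lt_trans (ler_norm _) (archi_boundP (normr_ge0 _))) _; rewrite ler_nat (leq_trans _ kP) //.
  exact: leq_maxr.
have Cyk : C (y *+ k).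
  by elim: (k) => [|m IH]; rewrite ?mulr0n // mulrS; exact: CD.
pose A := [set x; y *+ k].
have max_gaps : maximal_gaps C (C `\` below C A) = A.
  apply: maximal_gaps_setD_below => //.
  - by move=> _ [] ->.
  - case=> E; first by rewrite -E eqxx in x0.
    by move: xk; rewrite -E weight0.
  - move=> _ _ [] -> [] -> // => [/xNy//|/cone_le_weight].
    by rewrite leqNgt xk.
exists (C `\` below C A); split.
- apply: (C_semigroup_setD_below _ _ (weight (y *+ k))) => _ [] -> //.
  exact: ltnW.
(* As a maximal gap, [x] is in particular a gap. *)
- move=> SC; have : A x by left.
  by rewrite -max_gaps => -[[_]]; rewrite SC.
- rewrite /quasi_elasticity max_gaps (max_ofE _ (weight (y *+ k))).
  + rewrite (min_ofE _ (weight x)) ?ltr_pdivlMr ?ltr0n //.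
      by exists x => //; left.
    by move=> _ [_ [] -> <-] //; exact: ltnW.
  + by exists (y *+ k) => //; right.
  + by move=> _ [_ [] -> <-] //; exact: ltnW.
Qed.
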